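(* For each $\alpha\in(0,1/2]$ let $V_\alpha$ be a random variable uniformly distributed on $[0,2\alpha]$, and let $P$ be a random variable such that $P$ is independent of $V_\alpha$ for each $\alpha\in(0,1/2]$. Then $\mathbb P(P\le V_\alpha)\le\alpha$ for all $\alpha\in(0,1/2]$ if and only if $P$ is a p*-variable.
   Context: For random variables $X,Y$, $X\le_2 Y$ means $\mathbb E[f(X)]\le \mathbb E[f(Y)]$ for all increasing (non-strictly) concave real functions $f$ such that the expectations exist. A random variable $P$ is a p*-variable if $U\le_2 P$, where $U$ is uniform on $[0,1]$. *)

(* Defs.v *)
From HB Require Import structures.
From mathcomp Require Import all_boot all_order all_algebra.
From mathcomp Require Import all_classical all_reals all_analysis.

Set Implicit Arguments.
Unset Strict Implicit.
Unset Printing Implicit Defensive.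

Import Order.TTheory GRing.Theory Num.Theory.
Import numFieldNormedType.Exports.

Local Open Scope classical_set_scope.
Local Open Scope ring_scope.

Definition concave_function (R : realType) (f : R -> R) : Prop :=
  convex_function (setT : set R) (fun x => - f x).

(* The expectation exists as an element of [-oo, +oo], i.e., the positive and
   the negative parts do not both have infinite expectation. Requiring a finite
   expectation instead would make the order below degenerate: an X whose
   negative part has infinite mean has E[f(X)] = -oo for every nonconstant
   increasing concave f, so it would be comparable to everything. *)
Definition expectation_exists (R : realType) (d : measure_display)
    (T : measurableType d) (P : probability T R) (X : T -> R) : Prop :=
  ('E_P[(X^\+)%R] < +oo \/ 'E_P[(X^\-)%R] < +oo)%E.

(* X <=_2 Y, which depends only on the laws of X and Y: the two variables may
   live on different probability spaces. *)
Definition le_icv (R : realType)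
    (d1 : measure_display) (T1 : measurableType d1) (P1 : probability T1 R)
    (X : {RV P1 >-> R})
    (d2 : measure_display) (T2 : measurableType d2) (P2 : probability T2 R)
    (Y : {RV P2 >-> R}) : Prop :=
  forall f : R -> R, nondecreasing_fun f -> concave_function f ->
    expectation_exists P1 (f \o X) -> expectation_exists P2 (f \o Y) ->
    ('E_P1[f \o X] <= 'E_P2[f \o Y])%E.

Definition uniformly_distributed (R : realType) (d : measure_display)
    (T : measurableType d) (P : probability T R) (X : {RV P >-> R})
    (a b : R) : Prop :=
  exists ab : a < b, forall A : set R, measurable A ->
    distribution P X A = uniform_prob ab A.

Definition independent_RV (R : realType) (d : measure_display)
    (T : measurableType d) (P : probability T R) (X Y : {RV P >-> R}) : Prop :=
  forall A B : set R, measurable A -> measurable B ->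
    P (X @^-1` A `&` Y @^-1` B) = (P (X @^-1` A) * P (Y @^-1` B))%E.

Definition uniform01_fun (R : realType) : measurableTypeR R -> R := id.

HB.instance Definition _ (R : realType) :=
  @isMeasurableFun.Build _ _ _ _ (@uniform01_fun R) (@measurable_id _ _ setT).

(* The identity on R equipped with the uniform law on [0, 1]. *)
Definition uniform01 (R : realType) :
  {RV (uniform_prob (@ltr01 R)) >-> R} := @uniform01_fun R.

Lemma uniform01P (R : realType) : uniformly_distributed (uniform01 R) 0 1.
Proof. by exists ltr01 => A mA. Qed.

Definition p_star_variable (R : realType) (d : measure_display)
    (T : measurableType d) (P : probability T R) (X : {RV P >-> R}) : Prop :=
  le_icv (uniform01 R) X.

(* Main.v *)
(** Let [t = 2 alpha], write [(t - x)^+] for the hinge at [t], and let [U] be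
    uniform on [0, 1], so that [E (t - U)^+ = t^2 / 2] when [0 < t <= 1].
    Conditioning on [P] gives [Pr (P <= V_alpha) = E (t - max P 0)^+ / t], so the
    probability bound reads [E (t - max P 0)^+ <= E (t - U)^+].
    If [U <=_2 P], this follows by testing the order on [x |-> - (t - x)^+].
    Conversely, the bound forces [P >= 0] almost surely (let [alpha] tend to 0),
    so that [E (t - P)^+ <= E (t - U)^+] for [0 < t <= 1].  On [0, 1] an increasing
    concave [f] is a uniform limit of piecewise linear interpolants, each of them
    a constant minus a nonnegative combination of such hinges, and beyond 1 it
    suffices that [f P >= f (min P 1)]. *)

Require Import Defs.
From HB Require Import structures.
From mathcomp Require Import all_boot all_order all_algebra.
From mathcomp Require Import all_classical all_reals all_analysis.
From mathcomp Require Import measurable_realfun ring lra.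

Set Implicit Arguments.
Unset Strict Implicit.
Unset Printing Implicit Defensive.

Import Order.TTheory GRing.Theory Num.Theory.
Import numFieldNormedType.Exports.

Local Open Scope classical_set_scope.
Local Open Scope ring_scope.

Definition hinge (R : realType) (t x : R) : R := Num.max (t - x) 0.

Lemma hingeE (R : realType) (t x : R) : x <= t -> hinge t x = t - x.
Proof. by move=> xt; rewrite /hinge max_l // subr_ge0. Qed.

Lemma hinge_eq0 (R : realType) (t x : R) : t <= x -> hinge t x = 0.
Proof. by move=> tx; rewrite /hinge max_r // subr_le0. Qed.

Lemma hinge_ge0 (R : realType) (t x : R) : 0 <= hinge t x.
Proof. by rewrite /hinge le_max lexx orbT. Qed.

(** * Piecewise linear interpolation of a concave function by hinges *)

Section concave_interpolation.
Context (R : realType) (f : R -> R).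
Hypothesis f_nd : nondecreasing_fun f.
Hypothesis f_cc : concave_function f.

(** Unpacks the interval-typed weight of [convex_function], so that concavity becomes usable with
    plain real weights. *)
Lemma concave_chord (t a b : R) : 0 <= t <= 1 ->
  t * f a + (1 - t) * f b <= f (t * a + (1 - t) * b).
Proof.
move=> /andP[t0 t1].
have t01 : Itv.spec (@Itv.num_sem R) (Itv.Real `[0%Z, 1%Z]) t.
  by apply/and3P; split; [exact: num_real|rewrite bnd_simp..].
have := @f_cc (Itv.mk t01) a b (in_setT _) (in_setT _).
rewrite !convRE /= /unstable.onem !mulrN -opprD lerN2; exact.
Qed.

(** Comes from the chord inequality at [b], seen as the convex combination of [a] and [c] with
    weight [(c - b) / (c - a)]. Denominators are cleared to suit [nra]. *)
Lemma concave_slope (a b c : R) : a < b -> b < c ->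
  (f c - f b) * (b - a) <= (f b - f a) * (c - b).
Proof.
move=> ab bc; have ac : 0 < c - a by lra.
have t01 : 0 <= (c - b) / (c - a) <= 1.
  by rewrite divr_ge0 ?ler_pdivrMr //; lra.
have := @concave_chord _ a c t01.
have -> : (c - b) / (c - a) * a + (1 - (c - b) / (c - a)) * c = b.
  by field; lra.
rewrite -(ler_pM2l ac).
have -> : (c - a) * ((c - b) / (c - a) * f a + (1 - (c - b) / (c - a)) * f c) =
    (c - b) * f a + (b - a) * f c by field; lra.
by nra.
Qed.

(** The chord slope over [-1, 0]. Since chord slopes decrease to the right, it bounds all of them on
    the nonnegative half-line; it is finite because [f] is concave on the whole line. *)
Let L := f 0 - f (-1).

Lemma concave_lipschitz (a b : R) : 0 <= a -> a < b -> f b - f a <= L * (b - a).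
Proof.
rewrite le_eqVlt => /predU1P[<-|a0] ab.
  by have := @concave_slope (-1) 0 b ltac:(lra) ab; rewrite /L; lra.
have := @concave_slope (-1) 0 a ltac:(lra) a0.
have := @concave_slope 0 a b a0 ab.
rewrite /L => H1 H2.
rewrite -(ler_pM2r a0); nra.
Qed.

Variable h : R.

(** Nodes run leftwards from 1, so that each further hinge changes the sum only to the left of its
    node. *)
Definition grid (j : nat) : R := 1 - j%:R * h.
(** The index [j] refers to the cell whose left end is [grid j]. The value 0 at [j = 0] encodes the
    constant continuation beyond 1. *)
Definition slope (j : nat) : R :=
  if j is k.+1 then (f (grid k) - f (grid k.+1)) / h else 0.
Definition kink (j : nat) : R := slope j.+1 - slope j.
(** For [h > 0], this agrees with [f 1 - f (Num.min x 1)] at the nodes [grid 0] to [grid m], the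
    coefficients being the jumps of slope. *)
Definition interp (m : nat) (x : R) : R :=
  \sum_(j < m) kink j * hinge (grid j) x.

Lemma gridS j : grid j.+1 = grid j - h.
Proof. by rewrite /grid -natr1; ring. Qed.

Lemma interpS m x : interp m.+1 x = interp m x + kink m * hinge (grid m) x.
Proof. by rewrite /interp big_ord_recr. Qed.

Lemma slopeM j : 0 < h -> slope j.+1 * h = f (grid j) - f (grid j.+1).
Proof. by move=> h0; rewrite /slope divfK // gt_eqF. Qed.

(** At the node 1 this is monotonicity of [f]; at the other nodes it is concavity, slopes growing as
    the nodes move left. *)
Lemma kink_ge0 j : 0 < h -> 0 <= kink j.
Proof.
move=> h0; rewrite /kink; case: j => [|j].
  rewrite subr0 divr_ge0 ?(ltW h0) // subr_ge0 f_nd // gridS; lra.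
rewrite subr_ge0 -(ler_pM2r h0) !(slopeM _ h0).
have := @concave_slope (grid j.+2) (grid j.+1) (grid j).
rewrite !gridS => /(_ ltac:(lra) ltac:(lra)).
rewrite -(ler_pM2r h0) => H.
by rewrite -(ler_pM2r h0); nra.
Qed.

(** To the left of [grid m] all [m] hinges are active, and their coefficients telescope to
    [slope m]. *)
Lemma interp_affine m x : 0 < h -> x <= grid m ->
  interp m x = f 1 - f (grid m) + slope m * (grid m - x).
Proof.
move=> h0; elim: m => [|m IH] xy.
  by rewrite /interp big_ord0 /slope /grid !mul0r !subr0 subrr addr0.
rewrite interpS IH; last by move: xy; rewrite gridS; lra.
rewrite hingeE; last by move: xy; rewrite gridS; lra.
have := slopeM m h0; rewrite /kink gridS => E; lra.
Qed.

(** On the cell containing [x], the function and its interpolant both lie between the two node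
    values, which differ by at most [L * h]. Nodes must stay nonnegative for the Lipschitz bound to
    apply. *)
Lemma interp_approx m x : 0 < h -> 0 <= grid m -> grid m <= x ->
  `|f 1 - f (Num.min x 1) - interp m x| <= L * h.
Proof.
move=> h0; have L0 : 0 <= L by rewrite /L subr_ge0 f_nd //; lra.
elim: m x => [|m IH] x ym0 yx.
  rewrite /interp big_ord0 min_r; last by move: yx; rewrite /grid; lra.
  by rewrite subrr subr0 normr0 mulr_ge0 // ltW.
rewrite gridS in ym0.
(* Right of [grid m] the new hinge vanishes and induction applies; otherwise [x] lies in the last
   cell. *)
have [yx'|xy] := leP (grid m) x.
  rewrite interpS.
  rewrite hinge_eq0 //.
  by rewrite mulr0 addr0 IH //; lra.
have y1 : grid m <= 1 by rewrite /grid lerBlDr lerDl mulr_ge0 // ltW.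
rewrite min_l; last by lra.
rewrite interpS (interp_affine h0 (ltW xy)).
rewrite hingeE; last by lra.
have s0 : 0 <= slope m.+1.
  rewrite -(pmulr_lge0 _ h0) (slopeM _ h0) subr_ge0 f_nd // gridS; lra.
have fx1 : f x <= f (grid m) by rewrite f_nd // ltW.
have fx2 : f (grid m.+1) <= f x by rewrite f_nd.
have := @concave_lipschitz (grid m.+1) (grid m); rewrite -(slopeM _ h0) gridS.
move=> /(_ ltac:(lra) ltac:(lra)) Ls.
have shm := slopeM m h0.
rewrite gridS in shm yx fx2.
rewrite /kink ler_norml.
have p1 : 0 <= slope m.+1 * (grid m - x) by rewrite mulr_ge0 //; lra.
have p2 : slope m.+1 * (grid m - x) <= slope m.+1 * h.
  by rewrite ler_wpM2l //; lra.
nra.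
Qed.

Lemma concave_interpolation : 0 < h ->
  [/\ forall j, 0 <= kink j, forall j, grid j <= 1 &
    forall m x, 0 <= grid m -> grid m <= x ->
      `|f 1 - f (Num.min x 1) - \sum_(j < m) kink j * hinge (grid j) x|
        <= L * h].
Proof.
move=> h0; split=> [j|j|m x]; [exact: kink_ge0| |exact: interp_approx].
by rewrite /grid lerBlDr lerDl mulr_ge0 // ltW.
Qed.

End concave_interpolation.

Lemma concave_hinge_approx (R : realType) (f : R -> R) (e : R) :
  nondecreasing_fun f -> concave_function f -> 0 < e ->
  exists n (c y : nat -> R),
    [/\ forall j, 0 <= c j, forall j, (j < n)%N -> 0 < y j <= 1 &
      forall x : R, 0 <= x ->
        `|f 1 - f (Num.min x 1) - \sum_(j < n) c j * hinge (y j) x| <= e].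
Proof.
move=> f_nd f_cc e0.
pose L := f 0 - f (-1).
have L0 : 0 <= L by rewrite /L subr_ge0 f_nd //; lra.
(* [N] exceeds [L / e], so the error [L / N] is at most [e]. With step [1 / N] the node [N] is
   exactly 0, and the nodes carrying hinges are positive. *)
pose N := (Num.truncn (L / e)).+1.
pose h : R := N%:R^-1.
have h0 : 0 < h by rewrite invr_gt0.
have Lh : L * h <= e.
  rewrite /h ler_pdivrMr // mulrC -ler_pdivrMr //.
  by rewrite ltW // Num.Theory.truncnS_gt.
have [c_ge0 y1 approx] := concave_interpolation f_nd f_cc h0.
exists N, (kink f h), (grid h); split; first exact: c_ge0.
- move=> j jN; rewrite y1 andbT.
  by rewrite /grid subr_gt0 /h ltr_pdivrMr // mul1r ltr_nat.
- move=> x x0; apply: (le_trans _ Lh).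
  have gN : grid h N = 0 by rewrite /grid /h divff ?subrr // pnatr_eq0.
  by apply: approx; rewrite gN.
Qed.

(** * Expectations: almost sure comparison and hinge sums *)

Lemma le_integral_ae d (T : measurableType d) (R : realType)
    (mu : {measure set T -> \bar R}) (f g : T -> \bar R) :
  measurable_fun setT f -> measurable_fun setT g ->
  (\forall x \ae mu, f x <= g x)%E ->
  (\int[mu]_x f x <= \int[mu]_x g x)%E.
Proof.
move=> mf mg fg; rewrite integralE [leRHS]integralE.
(* Positive parts increase and negative parts decrease, which also covers infinite integrals. *)
apply: leeB; apply: ae_ge0_le_integral => //.
- exact: measurable_funepos.
- exact: measurable_funepos.
- apply: filterS fg => x fgx _; rewrite !funeposE ge_max le_max fgx /=.
  by rewrite le_max lexx orbT.
- exact: measurable_funeneg.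
- exact: measurable_funeneg.
- apply: filterS fg => x fgx _; rewrite !funenegE ge_max le_max leeN2 fgx /=.
  by rewrite le_max lexx orbT.
Qed.

Section expectations.
Context d (T : measurableType d) (R : realType) (P : probability T R).
Implicit Types X Y : T -> R.

Lemma le_expectation_ae X Y :
  measurable_fun setT X -> measurable_fun setT Y ->
  (\forall w \ae P, X w <= Y w) -> ('E_P[X] <= 'E_P[Y])%E.
Proof.
move=> mX mY XY; rewrite unlock; apply: le_integral_ae.
- exact/measurable_EFinP.
- exact/measurable_EFinP.
- by apply: filterS XY => w; rewrite lee_fin.
Qed.

Lemma ge0_expectationD_cst X (c : R) :
  measurable_fun setT X -> (forall w, 0 <= X w) -> 0 <= c ->
  ('E_P[(fun w => X w + c)%R] = 'E_P[X] + c%:E)%E.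
Proof.
move=> mX X0 c0; rewrite unlock.
under eq_integral do rewrite EFinD.
rewrite ge0_integralD //=.
- by rewrite integral_cst // [X in (_ * X)%E]probability_setT mule1.
- by move=> w _; rewrite lee_fin.
- exact/measurable_EFinP.
Qed.

Lemma expectation_cstB X (c : R) :
  measurable_fun setT X -> (forall w, 0 <= X w) -> ('E_P[X] < +oo)%E ->
  ('E_P[(fun w => c - X w)%R] = c%:E - 'E_P[X])%E.
Proof.
move=> mX X0; rewrite unlock => Xoo.
under eq_integral do rewrite EFinB.
rewrite integralB_EFin //=.
- by rewrite integral_cst // [X in (_ * X)%E]probability_setT mule1.
- exact: finite_measure_integrable_cst.
- apply/integrableP; split; first exact/measurable_EFinP.
  by under eq_integral do rewrite gee0_abs ?lee_fin //.
Qed.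

Lemma measurable_hinge (t : R) X :
  measurable_fun setT X -> measurable_fun setT (hinge t \o X).
Proof.
move=> mX; rewrite /hinge /comp.
by apply: measurable_maxr => //; exact: measurable_funB.
Qed.

Lemma expectation_sum_hinge X n (c y : nat -> R) :
  measurable_fun setT X -> (forall j, 0 <= c j) ->
  ('E_P[(fun w => \sum_(j < n) c j * hinge (y j) (X w))%R] =
  \sum_(j < n) (c j)%:E * 'E_P[hinge (y j) \o X])%E.
Proof.
move=> mX c0; rewrite unlock.
under eq_integral do rewrite -sumEFin.
rewrite ge0_integral_sum //=.
- apply: eq_bigr => j _; under eq_integral do rewrite EFinM.
  rewrite ge0_integralZl //= ?lee_fin //.
  + by apply/measurable_EFinP; exact: measurable_hinge.
  + by move=> w _; rewrite lee_fin hinge_ge0.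
- move=> j; apply/measurable_EFinP; apply: measurable_funM => //.
  exact: measurable_hinge.
- by move=> j w _; rewrite lee_fin mulr_ge0 // hinge_ge0.
Qed.

End expectations.

(** * Hinges as test functions for the increasing concave order *)

Lemma concave_oppr_hinge (R : realType) (t : R) :
  concave_function (fun x => - hinge t x).
Proof.
have hinge_chord (q a b : R) : 0 <= q <= 1 ->
    hinge t (q * a + (1 - q) * b) <= q * hinge t a + (1 - q) * hinge t b.
  (* A maximum of two affine functions is convex: each affine piece is bounded separately. *)
  move=> /andP[q0 q1]; rewrite {1}/hinge ge_max; apply/andP; split.
    have -> : t - (q * a + (1 - q) * b) = q * (t - a) + (1 - q) * (t - b).
      by ring.
    by apply: lerD; apply: ler_wpM2l; rewrite ?subr_ge0 // /hinge le_max lexx.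
  by rewrite addr_ge0 // mulr_ge0 ?subr_ge0 // hinge_ge0.
move=> p a b _ _; rewrite !convRE !opprK.
have p01 : 0 <= p%:num <= 1 by rewrite ge0 le1.
exact: (hinge_chord _ a b p01).
Qed.

Section increasing_concave_order.
Context (R : realType).
Context d1 (T1 : measurableType d1) (P1 : probability T1 R) (X : {RV P1 >-> R}).
Context d2 (T2 : measurableType d2) (P2 : probability T2 R) (Y : {RV P2 >-> R}).

Section loss.
Variable f : R -> R.
Hypothesis f_nd : nondecreasing_fun f.

(** Truncating at 1 makes this nonnegative and zero beyond 1, as are the hinge sums that approximate
    it. *)
Let loss (x : R) : R := f 1 - f (Num.min x 1).

Lemma loss_ge0 x : 0 <= loss x.
Proof. by rewrite subr_ge0 f_nd // ge_min lexx orbT. Qed.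

Lemma measurable_loss d (T : measurableType d) (Z : T -> R) :
  measurable_fun setT Z -> measurable_fun setT (loss \o Z).
Proof.
move=> mZ; apply: measurableT_comp => //.
apply: nonincreasing_measurable => // x y xy.
by rewrite lerB // f_nd // le_min2.
Qed.

(** Replace [loss] by a hinge sum [g], compare [g] term by term, and go back. Each replacement costs
    [e / 2] and is valid only where the variable is nonnegative. *)
Lemma le_expectation_loss : concave_function f ->
  (\forall w \ae P1, 0 <= X w) -> (\forall w \ae P2, 0 <= Y w) ->
  (forall t : R, 0 < t <= 1 ->
    ('E_P2[hinge t \o Y] <= 'E_P1[hinge t \o X])%E) ->
  ('E_P2[loss \o Y] <= 'E_P1[loss \o X])%E.
Proof.
move=> f_cc X0 Y0 XY; apply/lee_addgt0Pr => e e0.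
have e2 : 0 < e / 2 by rewrite divr_gt0.
have [n [c [y [c0 y01 approx]]]] := concave_hinge_approx f_nd f_cc e2.
pose g x := \sum_(j < n) c j * hinge (y j) x.
have g0 x : 0 <= g x by apply: sumr_ge0 => j _; rewrite mulr_ge0 // hinge_ge0.
have mg d (T : measurableType d) (Z : T -> R) :
    measurable_fun setT Z -> measurable_fun setT (g \o Z).
  move=> mZ; apply: measurable_sum => j; apply: measurable_funM => //.
  exact: measurable_hinge.
apply: (@le_trans _ _ ('E_P2[fun w => (g (Y w) + e / 2)%R])%E).
  apply: le_expectation_ae.
  - exact: measurable_loss.
  - by apply: measurable_funD => //; exact: (mg _ _ Y).
  - apply: filterS Y0 => w Yw.
    have := approx _ Yw; rewrite ler_norml => /andP[_].
    by rewrite -/(loss _) -/(g _) lerBlDl.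
rewrite (@ge0_expectationD_cst _ _ _ _ (g \o Y) _ _ _ (ltW e2)); last 2 first.
- exact: mg.
- by move=> w; exact: g0.
rewrite [in leRHS](splitr e) EFinD addeA leeD2r //.
rewrite -(@ge0_expectationD_cst _ _ _ _ (loss \o X) _ _ _ (ltW e2));
  last 2 first.
- exact: measurable_loss.
- by move=> w; exact: loss_ge0.
apply: (@le_trans _ _ ('E_P1[g \o X])%E).
  rewrite !expectation_sum_hinge //; apply: lee_sum => j _.
  by rewrite lee_wpmul2l ?lee_fin // XY // y01.
apply: le_expectation_ae.
- exact: mg.
- by apply: measurable_funD => //; exact: (measurable_loss (Z := X)).
- apply: filterS X0 => w Xw.
  have := approx _ Xw; rewrite ler_norml => /andP[+ _].
  by rewrite -/(loss _) -/(g _) lerBrDl => H /=; lra.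
Qed.

End loss.

(** Almost surely [f X = f 1 - loss X], because [X <= 1], while [f Y >= f 1 - loss Y] always; the
    order is thus reduced to the comparison of losses. *)
Lemma le_icv_of_hinge :
  (\forall w \ae P1, 0 <= X w <= 1) -> (\forall w \ae P2, 0 <= Y w) ->
  (forall t : R, 0 < t <= 1 ->
    ('E_P2[hinge t \o Y] <= 'E_P1[hinge t \o X])%E) ->
  le_icv X Y.
Proof.
move=> X01 Y0 XY f f_nd f_cc _ _.
have X0 : \forall w \ae P1, 0 <= X w by apply: filterS X01 => w /andP[].
have YX := le_expectation_loss f_nd f_cc X0 Y0 XY.
pose loss x := f 1 - f (Num.min x 1).
(* As [X >= 0], the loss is at most [f 1 - f 0]. Finiteness passes on to [Y] and permits subtracting
   expectations from [f 1]. *)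
have lossXoo : ('E_P1[loss \o X] < +oo)%E.
  apply: (@le_lt_trans _ _ ('E_P1[cst (f 1 - f 0)%R])%E); last first.
    by rewrite expectation_cst ltry.
  apply: le_expectation_ae => //; first exact: measurable_loss.
  apply: filterS X0 => w Xw.
  by rewrite /loss /= lerB // f_nd // le_min Xw ler01.
have lossYoo := le_lt_trans YX lossXoo.
have mf : measurable_fun setT f by exact: nondecreasing_measurable.
apply: (@le_trans _ _ ('E_P1[fun w => (f 1 - loss (X w))%R])%E).
  apply: le_expectation_ae.
  - exact: measurableT_comp.
  - by apply: measurable_funB => //; exact: (measurable_loss f_nd (Z := X)).
  - apply: filterS X01 => w /andP[_ X1].
    by rewrite /loss min_l //= subKr.
apply: (@le_trans _ _ ('E_P2[fun w => (f 1 - loss (Y w))%R])%E); last first.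
  apply: le_expectation_ae.
  - by apply: measurable_funB => //; exact: (measurable_loss f_nd (Z := Y)).
  - exact: measurableT_comp.
  - by apply: nearW => w; rewrite /loss subKr f_nd // ge_min lexx.
rewrite (@expectation_cstB _ _ _ _ (loss \o X)) //; last 2 first.
- exact: measurable_loss.
- by move=> w; exact: loss_ge0.
rewrite (@expectation_cstB _ _ _ _ (loss \o Y)) //; last 2 first.
- exact: measurable_loss.
- by move=> w; exact: loss_ge0.
exact: leeB.
Qed.

Lemma le_hinge_of_icv t : le_icv X Y ->
  ('E_P2[hinge t \o Y] <= 'E_P1[hinge t \o X])%E.
Proof.
move=> XY.
(* The test function is nonpositive, so its positive part has expectation 0. *)
have exi d (T : measurableType d) (P : probability T R) (Z : {RV P >-> R}) :
    expectation_exists P ((fun x => - hinge t x) \o Z).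
  left; rewrite unlock (eq_integral (cst 0)%E).
    by rewrite integral_cst // mul0e ltry.
  move=> w _ /=; rewrite /funrpos max_r // oppr_le0; exact: hinge_ge0.
have nd : nondecreasing_fun (fun x : R => - hinge t x).
  by move=> x y xy; rewrite lerN2 /hinge le_max2 // lerD2l lerN2.
have := XY _ nd (concave_oppr_hinge t) (exi _ _ _ X) (exi _ _ _ Y).
have E d (T : measurableType d) (P : probability T R) (Z : {RV P >-> R}) :
    ('E_P[(fun x => - hinge t x)%R \o Z] = - 'E_P[hinge t \o Z])%E.
  rewrite unlock; under eq_integral do rewrite /= EFinN.
  by rewrite integral_ge0N // => w _; rewrite lee_fin hinge_ge0.
by rewrite !E leeN2.
Qed.

End increasing_concave_order.

(** * The uniform law, and comparison with an independent uniform variable *)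

Section uniform.
Context (R : realType) (t : R) (t0 : 0 < t).

(** Only the part of the half-line inside [0, t] counts: the maximum clips [x] from below, giving 1
    for negative [x], and the hinge gives 0 beyond [t]. *)
Lemma uniform_prob_tail (x : R) :
  uniform_prob t0 `[x, +oo[ = (hinge t (Num.max x 0) / t)%:E.
Proof.
rewrite /uniform_prob integral_uniform_pdf.
rewrite (_ : _ `&` _ = `[Num.max x 0, t]%classic); last first.
  apply/seteqP; split => y /=; rewrite !in_itv /= andbT ge_max.
    by move=> [-> ->].
  by move=> /andP[/andP[-> ->] ->].
rewrite (eq_integral (cst t^-1%:E)); last first.
  move=> y; rewrite inE /= in_itv /= ge_max => /andP[/andP[_ y0] yt].
  by rewrite /uniform_pdf y0 yt subr0.
rewrite integral_cst //= lebesgue_measure_itv /= lte_fin.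
case: ltP => xt; first by rewrite hingeE ?ltW // -EFinB -EFinM mulrC.
by rewrite hinge_eq0 // mule0 mul0r.
Qed.

Lemma expectation_hinge_uniform01 : t <= 1 ->
  ('E_(uniform_prob (@ltr01 R))[hinge t \o uniform01 R] = (t ^+ 2 / 2)%R%:E)%E.
Proof.
move=> t1; rewrite -[_ \o _]/(hinge t) unlock integral_uniform; last 2 first.
- apply/measurable_EFinP.
  exact: (@measurable_hinge _ _ _ t id (@measurable_id _ _ setT)).
- by move=> x; rewrite lee_fin hinge_ge0.
rewrite subr0 invr1 mul1e.
(* The hinge vanishes beyond [t], and [t <= 1] keeps [0, t] inside the support. *)
transitivity (\int[lebesgue_measure]_(x in `[0%R, t]) (t - x)%:E)%E.
  rewrite [LHS]integral_mkcond [RHS]integral_mkcond; apply: eq_integral => x _.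
  rewrite !patchE; case: ifPn; case: ifPn => //.
  - by rewrite inE /= in_itv /= => /andP[_ xt] _; rewrite hingeE.
  - rewrite inE notin_setE /= !in_itv /= => /negP + /andP[x0 _].
    by rewrite x0 /= -ltNge => /ltW tx; rewrite hinge_eq0.
  - rewrite inE notin_setE /= !in_itv /= => /andP[-> xt].
    by rewrite (le_trans xt).
pose F (x : R) : R := t * x - x ^+ 2 / 2.
have dF (x : R) : is_derive x 1 F (t - x).
  rewrite /F; apply: is_derive_eq.
  by rewrite !scaler0 add0r /GRing.scale /= !mulr1; field.
have cF : continuous F.
  by move=> x; apply/differentiable_continuous/derivable1_diffP; case: (dF x).
have cf : {within `[0, t], continuous (fun x : R => t - x)}.
  apply: continuous_subspaceT => x.
  by apply: continuousB; [exact: cst_continuous|exact: id].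
rewrite (@continuous_FTC2 _ (fun x : R => t - x) F _ _ t0 cf).
- by rewrite /F -EFinB; congr EFin; field.
- split=> [x _| |]; first by case: (dF x).
  + by apply: cvg_at_right_filter; exact: cF.
  + by apply: cvg_at_left_filter; exact: cF.
- by move=> x _; rewrite derive1E; apply: derive_val.
Qed.

End uniform.

(** Independence makes the joint law agree with the product measure on rectangles, hence everywhere;
    the set [x <= y] is then measured by its vertical sections. *)
Lemma probability_le_independent d (T : measurableType d) (R : realType)
    (P : probability T R) (X Y : {RV P >-> R}) : independent_RV X Y ->
  P [set w | X w <= Y w] =
    (\int[P]_w distribution P Y `[X w, +oo[%classic)%E.
Proof.
move=> XY.
have mXY : measurable_fun setT (fun w => (X w, Y w) : R * R).
  exact: measurable_fun_pair.
pose Z : {mfun T >-> (R * R)%type} :=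
  HB.pack (fun w => (X w, Y w) : R * R) (isMeasurableFun.Build _ _ _ _ _ mXY).
pose A : set (R * R) := [set z | z.1 <= z.2].
have mA : measurable A.
  by rewrite -[A]setTI; apply: measurable_fun_le.
have -> : P [set w | X w <= Y w] = distribution P Z A by [].
have indep (B C : set R) : measurable B -> measurable C ->
    distribution P Z (B `*` C) = (distribution P X B * distribution P Y C)%E.
  by move=> mB mC; exact: XY.
rewrite -(product_measure_unique indep mA).
rewrite /product_measure1 ge0_integral_distribution //; last first.
  exact: measurable_fun_xsection.
apply: eq_integral => w _ /=; congr (distribution P Y _).
by apply/seteqP; split => y; rewrite /xsection /A /= in_itv /= andbT in_setE.
Qed.

Section uniform_bound.
Context (R : realType) (d : measure_display) (T : measurableType d).
Context (Pr : probability T R) (P V : {RV Pr >-> R}) (t : R).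
Hypotheses (t0 : 0 < t) (V_unif : uniformly_distributed V 0 t).
Hypothesis PV : independent_RV P V.

Lemma probability_le_uniform :
  Pr [set w | P w <= V w] =
    (t^-1%:E * 'E_Pr[fun w => hinge t (Num.max (P w) 0)%R])%E.
Proof.
rewrite probability_le_independent // unlock.
rewrite -ge0_integralZl //=; last 3 first.
- apply/measurable_EFinP; apply: measurable_hinge.
  exact: measurable_maxr.
- by move=> w _; rewrite lee_fin hinge_ge0.
- by rewrite lee_fin invr_ge0 ltW.
apply: eq_integral => w _.
have [ab ->] := V_unif; last exact: measurable_itv.
(* [ab] is the proof of [0 < t] hidden in [V_unif]; it equals [t0] by proof irrelevance. *)
by rewrite (_ : ab = t0) // uniform_prob_tail -EFinM mulrC.
Qed.

(** Since [V >= 0] almost surely, independence lets [V >= 0] be added to the event [P < 0] at no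
    cost, and together they imply [P <= V]. *)
Lemma probability_lt0_le :
  (Pr [set w | (P w < 0)%R] <= Pr [set w | (P w <= V w)%R])%E.
Proof.
have V0 : Pr (V @^-1` `[0, +oo[) = 1%E.
  have [ab VE] := V_unif.
  rewrite -[LHS]/(distribution Pr V _) VE; last exact: measurable_itv.
  rewrite (_ : ab = t0) // uniform_prob_tail maxxx hingeE ?ltW //.
  by rewrite subr0 divff ?gt_eqF.
have P0 : [set w | P w < 0] = P @^-1` `]-oo, 0[.
  by apply/seteqP; split => w; rewrite /= in_itv.
rewrite P0 -[leLHS]mule1 -V0 -PV; [|exact: measurable_itv..].
apply: le_measure; rewrite ?inE.
- apply: measurableI; rewrite -[X in measurable X]setTI;
    by apply: measurable_funPT.
- by rewrite -[X in measurable X]setTI; exact: measurable_fun_le.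
- move=> w [/=]; rewrite !in_itv /= andbT => Pw Vw.
  by rewrite ltW // (lt_le_trans Pw).
Qed.

End uniform_bound.

(** * The equivalence *)

Lemma uniform01_ae (R : realType) :
  \forall x \ae uniform_prob (@ltr01 R), 0 <= uniform01 R x <= 1.
Proof.
exists (~` `[0, 1]%classic); split.
- exact: measurableC.
- rewrite [LHS]integral_uniform_pdf setICl; exact: integral_set0.
- move=> x /= x01; rewrite in_itv /=; exact: x01.
Qed.

Theorem proposition4p5 (R : realType) (d : measure_display)
    (Omega : measurableType d) (Pr : probability Omega R)
    (V : R -> {RV Pr >-> R}) (P : {RV Pr >-> R})
    (hV : forall alpha : R, 0 < alpha <= 1 / 2 ->
      uniformly_distributed (V alpha) 0 (2 * alpha))
    (hPV : forall alpha : R, 0 < alpha <= 1 / 2 ->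
      independent_RV P (V alpha)) :
  (forall alpha : R, 0 < alpha <= 1 / 2 ->
    (Pr [set w | (P w <= V alpha w)%R] <= alpha%:E)%E) <->
  p_star_variable P.
Proof.
have mP0 : measurable_fun setT (fun w => Num.max (P w) 0).
  exact: measurable_maxr.
split=> [PV|pstar alpha alpha_itv]; last first.
  have /andP[a0 a1] := alpha_itv.
  have t0 : 0 < 2 * alpha by lra.
  rewrite (probability_le_uniform t0 (hV _ alpha_itv) (hPV _ alpha_itv)).
  rewrite muleC lee_pdivrMr //.
  apply: (@le_trans _ _ ('E_Pr[hinge (2 * alpha)%R \o P])%E).
    apply: le_expectation_ae.
    - exact: measurable_hinge.
    - exact: measurable_hinge.
    (* Raising [P] to [max P 0] can only lower the hinge. *)
    - apply: nearW => w; rewrite /hinge /= le_max2 // lerB // le_max lexx //.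
  apply: (le_trans (le_hinge_of_icv (2 * alpha) pstar)).
  rewrite (expectation_hinge_uniform01 t0); last by lra.
  by rewrite -EFinM lee_fin; lra.
have P0 : \forall w \ae Pr, 0 <= P w.
  exists [set w | P w < 0]; split.
  - rewrite (_ : [set _ | _] = P @^-1` `]-oo, 0[).
      by rewrite -[X in measurable X]setTI; apply: measurable_funPT.
    by apply/seteqP; split => w; rewrite /= in_itv.
  - apply/eqP; rewrite eq_le measure_ge0 andbT.
    apply/lee_addgt0Pr => e e0; rewrite add0e.
    (* The cap at 1/2 keeps [alpha] admissible; then [Pr (P < 0) <= alpha <= e]. *)
    pose alpha := Num.min e (1 / 2).
    have alpha_itv : 0 < alpha <= 1 / 2.
      by rewrite lt_min e0 ge_min lexx orbT /=; lra.
    apply: (@le_trans _ _ alpha%:E); last by rewrite lee_fin ge_min lexx.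
    apply: le_trans (PV _ alpha_itv).
    apply: (probability_lt0_le _ (hV _ alpha_itv) (hPV _ alpha_itv)).
    by case/andP: alpha_itv => ? _; lra.
  - by move=> w /= /negP; rewrite -ltNge.
apply: le_icv_of_hinge => // [|t t01].
  exact: uniform01_ae.
have /andP[t0 t1] := t01.
(* The level [t / 2] has its uniform variable on [0, t], so the bound becomes a hinge inequality at
   [t], with right side [t / 2 * t]. *)
have a_itv : 0 < t / 2 <= 1 / 2 by lra.
have t2 : 2 * (t / 2) = t by field.
have V_unif := hV _ a_itv; rewrite t2 in V_unif.
rewrite (expectation_hinge_uniform01 t0 t1).
have := PV _ a_itv.
rewrite (probability_le_uniform t0 V_unif (hPV _ a_itv)).
rewrite muleC lee_pdivrMr // => H.
apply: (@le_trans _ _ ('E_Pr[fun w => hinge t (Num.max (P w) 0)%R])%E).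
  apply: le_expectation_ae.
  - exact: measurable_hinge.
  - exact: (measurable_hinge t mP0).
  (* Almost sure nonnegativity removes the truncation of [P] at 0. *)
  - by apply: filterS P0 => w Pw; rewrite max_l.
apply: (le_trans H).
by rewrite -EFinM lee_fin; lra.
Qed.
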